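(* Let $X$ be a zero-dimensional topological space. Then the following statements hold: (1) The mildly Menger game $G_{fin}(\mathcal{C}_{\mathcal{O}}, \mathcal{C}_{\mathcal{O}})$ on $X$ is equivalent to the Menger game $G_{fin}(\mathcal{O}, \mathcal{O})$ on $X$. (2) The compact-clopen game on $X$ is equivalent to the compact-open game on $X$.
   Context: A set is clopen if it is both open and closed. A space is zero-dimensional if it is nonempty and has a base consisting of clopen sets. For a space $X$, $\mathcal{O}$ is the collection of all open covers of $X$ and $\mathcal{C}_{\mathcal{O}}$ is the collection of all clopen covers of $X$ (covers by clopen subsets of $X$). For collections $\mathcal{A},\mathcal{B}$ of open covers of $X$, the game $G_{fin}(\mathcal{A},\mathcal{B})$ is played by ONE and TWO in innings $n\in\omega$: in inning $n$, ONE chooses $A_n\in\mathcal{A}$, and then TWO chooses a finite subset $B_n\subseteq A_n$. TWO wins the play if $\bigcup_{n\in\omega} B_n\in\mathcal{B}$; otherwise ONE wins. The compact-open game (respectively, compact-clopen game) on $X$: in each inning $n\in\omega$, ONE picks a compact set $K_n\subseteq X$, and then TWO chooses an open (respectively, clopen) set $U_n\subseteq X$ with $K_n\subseteq U_n$. ONE wins the play if $X\subseteq\bigcup_{n\in\omega}U_n$; otherwise TWO wins. A strategy for a player is a function assigning a legal move to each finite sequence of the opponent's previous moves (for TWO, including the opponent's current move); it is winning if the player wins every play in which it is followed. Two games $G$ and $G'$ are equivalent if ONE has a winning strategy in $G$ if and only if ONE has a winning strategy in $G'$, and TWO has a winning strategy in $G$ if and only if TWO has a winning strategy in $G'$. 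*)

(* Defs.v *)
From mathcomp Require Import all_boot.
From mathcomp Require Import all_classical topology.

Set Implicit Arguments.
Unset Strict Implicit.
Unset Printing Implicit Defensive.

Local Open Scope classical_set_scope.

(* Two-player games of length omega with perfect information.  A play is a pair
   of sequences a (ONE's moves) and b (TWO's moves) in which a n is played just
   before b n; every play not won by ONE is won by TWO. *)
Record game : Type := Game {
  move1 : Type;
  move2 : Type;
  legal1 : set move1;
  (* the moves open to TWO in answer to ONE's current move *)
  legal2 : move1 -> set move2;
  one_wins : (nat -> move1) -> (nat -> move2) -> Prop
}.

(* The finite sequence of the opponent's moves in innings 0, ..., n-1 is
   written [mkseq b n], where only the first n terms of b matter. *)

(* In inning n, ONE following sigma plays sigma [:: b 0; ...; b n.-1]. *)
Definition strategy1 (G : game) (sigma : seq (move2 G) -> move1 G) : Prop :=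
  forall (b : nat -> move2 G) (n : nat),
    (forall i, (i < n)%N -> legal2 (sigma (mkseq b i)) (b i)) ->
    legal1 (sigma (mkseq b n)).

(* In inning n, TWO following tau plays tau [:: a 0; ...; a n]. *)
Definition strategy2 (G : game) (tau : seq (move1 G) -> move2 G) : Prop :=
  forall (a : nat -> move1 G) (n : nat),
    (forall i, (i <= n)%N -> legal1 (a i)) ->
    legal2 (a n) (tau (mkseq a n.+1)).

Definition winning1 (G : game) (sigma : seq (move2 G) -> move1 G) : Prop :=
  strategy1 sigma /\
  forall b : nat -> move2 G,
    (forall n, legal2 (sigma (mkseq b n)) (b n)) ->
    one_wins (fun n => sigma (mkseq b n)) b.

Definition winning2 (G : game) (tau : seq (move1 G) -> move2 G) : Prop :=
  strategy2 tau /\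
  forall a : nat -> move1 G,
    (forall n, legal1 (a n)) ->
    ~ one_wins a (fun n => tau (mkseq a n.+1)).

Definition equivalent_games (G G' : game) : Prop :=
  ((exists sigma, @winning1 G sigma) <-> (exists sigma, @winning1 G' sigma)) /\
  ((exists tau, @winning2 G tau) <-> (exists tau, @winning2 G' tau)).

Section Topology.
Variable X : topologicalType.

(* This differs from the library's [zero_dimensional], which only asks that
   distinct points be separated by clopen sets. *)
Definition zero_dimensional_space : Prop :=
  [set: X] !=set0 /\ exists2 B : set (set X), basis B & B `<=` clopen.

Definition open_covers : set (set (set X)) :=
  [set U | U `<=` open /\ \bigcup_(A in U) A = [set: X]].

Definition clopen_covers : set (set (set X)) :=
  [set U | U `<=` clopen /\ \bigcup_(A in U) A = [set: X]].

Definition Gfin (A B : set (set (set X))) : game :=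
  {| move1 := set (set X);
     move2 := set (set X);
     legal1 := A;
     legal2 := fun U => [set V | finite_set V /\ V `<=` U];
     one_wins := fun _ V => ~ B (\bigcup_n V n) |}.

(* ONE plays compact sets, TWO answers with supersets belonging to P. *)
Definition compact_superset_game (P : set (set X)) : game :=
  {| move1 := set X;
     move2 := set X;
     legal1 := compact;
     legal2 := fun K => [set U | P U /\ K `<=` U];
     one_wins := fun _ U => [set: X] `<=` \bigcup_n U n |}.

Definition compact_open_game : game := compact_superset_game open.

Definition compact_clopen_game : game := compact_superset_game clopen.

End Topology.

Arguments open_covers X : clear implicits.
Arguments clopen_covers X : clear implicits.
Arguments compact_open_game X : clear implicits.
Arguments compact_clopen_game X : clear implicits.

(* Main.v *)
(** Both parts are instances of one simulation principle.  Translate ONE's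
    moves of a game [G] into moves of a game [G'] by [phi], and TWO's answers
    in [G'] back into answers in [G] by [psi].  If legality is respected and
    ONE's wins in [G] carry over to the translated plays of [G'], then ONE's
    winning strategies pass from [G] to [G'] and TWO's from [G'] to [G].
    Between the clopen and the open games the identity translates one way.
    The other way, an open cover is replaced by its clopen refinement, each
    clopen set chosen being enlarged to a member of the open cover, while an
    open set answering a compact set [K] is shrunk to a clopen set
    containing [K]. *)

Require Import Defs.
From HB Require Import structures.
From mathcomp Require Import all_boot finmap.
From mathcomp Require Import all_classical topology.

Set Implicit Arguments.
Unset Strict Implicit.
Unset Printing Implicit Defensive.

Local Open Scope classical_set_scope.

Section Simulation.
Variables (G G' : game).
Variables (phi : move1 G -> move1 G') (psi : move1 G -> move2 G' -> move2 G).
Hypothesis legal_phi : forall a, legal1 a -> legal1 (phi a).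
Hypothesis legal_psi :
  forall a b, legal1 a -> legal2 (phi a) b -> legal2 a (psi a b).
Hypothesis one_wins_sim : forall a b,
  (forall n, legal1 (a n)) -> (forall n, legal2 (phi (a n)) (b n)) ->
  one_wins a (fun n => psi (a n) (b n)) -> one_wins (fun n => phi (a n)) b.

Lemma winning1_simulation :
  (exists sigma, @winning1 G sigma) -> exists sigma, @winning1 G' sigma.
Proof.
move=> [sigma [sigmaP sigmaW]].
(* Pulling one answer back through [psi] requires ONE's current move in [G], which [sigma] computes
   from the answers already pulled back. Hence the history is translated by a left fold. *)
pose tr := foldl (fun acc v => rcons acc (psi (sigma acc) v)) [::].
have trE b n : tr (mkseq b n) =
    mkseq (fun i => psi (sigma (tr (mkseq b i))) (b i)) n.
  by elim: n => [//|n IHn]; rewrite !mkseqS /tr foldl_rcons -/(tr _) IHn.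
have legal b n :
    (forall i, i < n -> legal2 (phi (sigma (tr (mkseq b i)))) (b i)) ->
    legal1 (sigma (tr (mkseq b n))).
  (* Strong induction: [sigma] is legal at inning [n] only if every earlier translated answer is,
     and [legal_psi] gives this from the legality of ONE's moves before [n]. *)
  elim/ltn_ind: n => n IHn bP; rewrite trE; apply: sigmaP => i ltin.
  rewrite -trE; apply: legal_psi (bP i ltin); apply: IHn => // j ltji.
  exact/bP/(ltn_trans ltji).
exists (phi \o sigma \o tr); split=> [b n bP | b bP].
  by apply: legal_phi; exact: legal.
apply: (@one_wins_sim (fun n => sigma (tr (mkseq b n)))) => //.
  by move=> n; apply: legal => i _; exact: bP.
pose c n := psi (sigma (tr (mkseq b n))) (b n).
have -> : (fun n => sigma (tr (mkseq b n))) = (fun n => sigma (mkseq c n)).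
  by apply: funext => n; rewrite trE.
apply: sigmaW => n; rewrite -trE; apply: legal_psi (bP n).
by apply: legal => i _; exact: bP.
Qed.

Lemma winning2_simulation (a0 : move1 G) :
  (exists tau, @winning2 G' tau) -> exists tau, @winning2 G tau.
Proof.
move=> [tau [tauP tauW]].
(* The last entry of the history is ONE's current move; [a0] is a default for the empty history, on
   which TWO never has to move. *)
pose tau' s := psi (last a0 s) (tau (map phi s)).
have tau'E a n : tau' (mkseq a n.+1) =
    psi (a n) (tau (mkseq (fun i => phi (a i)) n.+1)).
  by rewrite /tau' {1}mkseqS last_rcons /mkseq -map_comp.
have legal a n : (forall i, i <= n -> legal1 (a i)) ->
    legal2 (phi (a n)) (tau (mkseq (fun i => phi (a i)) n.+1)).
  by move=> aP; apply: tauP => i lein; exact/legal_phi/aP.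
exists tau'; split=> [a n aP | a aP].
  by rewrite tau'E; apply: legal_psi; [exact: aP | exact: legal].
under eq_fun do rewrite tau'E.
move=> /(one_wins_sim aP (fun n => legal a n (fun i _ => aP i))).
by apply: tauW => n; exact: legal_phi.
Qed.

End Simulation.

Section ZeroDimensional.
Variable X : topologicalType.
Hypothesis hX : zero_dimensional_space X.

Lemma clopen_nbhs (U : set X) x : open U -> U x ->
  exists C : set X, [/\ clopen C, C x & C `<=` U].
Proof.
case: hX => _ [B [_ Bbase] Bclopen] Uo Ux.
have [C [BC Cx] CU] := Bbase x U (open_nbhs_nbhs (conj Uo Ux)).
by exists C; split=> //; exact: Bclopen.
Qed.

(** The clopen subsets of [U] cover [K]; the union of a finite subcover is still closed, hence
    clopen. *)
Lemma compact_clopen_superset (K U : set X) : compact K -> open U ->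
  K `<=` U -> exists C : set X, [/\ clopen C, K `<=` C & C `<=` U].
Proof.
move=> cK Uo KU; have [[x0 _] _] := hX.
(* The library characterises compactness by covers on pointed spaces only. *)
pose pX : ptopologicalType := HB.pack X (isPointed.Build X x0).
have : @cover_compact pX K by rewrite -compact_cover.
move=> /(_ (set X) [set C | clopen C /\ C `<=` U] id) [].
- by move=> C [[]].
- move=> x Kx; have [C [cC Cx CU]] := clopen_nbhs Uo (KU x Kx).
  by exists C.
move=> D DP KD; exists (\bigcup_(C in [set` D]) C); split.
- split.
  + by apply: bigcup_open => C /DP/set_mem[[]].
  + by apply: closed_bigcup => // C /DP/set_mem[[]].
- exact: KD.
- by apply: bigcup_sub => C /DP/set_mem[].
Qed.

Definition clopen_refinement (U : set (set X)) : set (set X) :=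
  [set C | clopen C /\ exists2 A, U A & C `<=` A].

Definition enlarge (U : set (set X)) (C : set X) : set X :=
  xget set0 [set A | U A /\ C `<=` A].

Lemma clopen_refinement_cover U :
  open_covers X U -> clopen_covers X (clopen_refinement U).
Proof.
move=> [Uo Ucov]; split=> [C []//|].
apply/seteqP; split=> // x _.
have [A UA Ax] : (\bigcup_(A in U) A) x by rewrite Ucov.
have [C [cC Cx CA]] := clopen_nbhs (Uo _ UA) Ax.
by exists C => //; split=> //; exists A.
Qed.

Lemma enlargeP U C :
  clopen_refinement U C -> U (enlarge U C) /\ C `<=` enlarge U C.
Proof.
move=> [_ [A UA CA]].
by apply: (@xgetPex _ set0 [set B | U B /\ C `<=` B]); exists A.
Qed.

Definition clopen_core (K U : set X) : set X :=
  xget set0 [set C | [/\ clopen C, K `<=` C & C `<=` U]].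

Lemma clopen_coreP K U : compact K -> open U -> K `<=` U ->
  [/\ clopen (clopen_core K U), K `<=` clopen_core K U
    & clopen_core K U `<=` U].
Proof.
by move=> cK Uo KU; exact: (xgetPex set0 (compact_clopen_superset cK Uo KU)).
Qed.

Lemma Gfin_clopen_open_equivalent :
  equivalent_games (Gfin (clopen_covers X) (clopen_covers X))
                   (Gfin (open_covers X) (open_covers X)).
Proof.
set Gc := Gfin _ _; set Go := Gfin _ _.
have co_legal1 (U : move1 Gc) : legal1 U -> @legal1 Go U.
  by move=> [Uc Ucov]; split=> // A /Uc[].
have co_wins (a : nat -> move1 Gc) (b : nat -> move2 Go) :
    (forall n, legal1 (a n)) -> (forall n, @legal2 Go (a n) (b n)) ->
    @one_wins Gc a b -> @one_wins Go a b.
  (* By contraposition: all sets selected by TWO come from clopen covers, so once they cover [X]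
     they form a clopen cover. *)
  move=> aP bP; apply: contra_not => -[_ bcov]; split=> // A [n _ bnA].
  by have [_ /(_ _ bnA) anA] := bP n; have [/(_ _ anA)] := aP n.
have oc_legal2 (U : move1 Go) (V : move2 Gc) : legal1 U ->
    @legal2 Gc (clopen_refinement U) V -> @legal2 Go U (enlarge U @` V).
  move=> _ [Vfin VU]; split; first exact: finite_image.
  by move=> _ [C /VU /enlargeP[] ? _ <-].
have oc_wins (a : nat -> move1 Go) (b : nat -> move2 Gc) :
    (forall n, legal1 (a n)) ->
    (forall n, @legal2 Gc (clopen_refinement (a n)) (b n)) ->
    @one_wins Go a (fun n => enlarge (a n) @` b n) ->
    @one_wins Gc (fun n => clopen_refinement (a n)) b.
  (* By contraposition: enlarging keeps every covered point covered, and the enlarged sets are open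
     as members of the covers [a n]. *)
  move=> aP bP; apply: contra_not => -[_ bcov]; split.
    move=> A [n _ bnA]; have [_ /(_ _ bnA) anA] := oc_legal2 _ _ (aP n) (bP n).
    by have [/(_ _ anA)] := aP n.
  apply/seteqP; split=> // x _.
  have [C [n _ bnC] Cx] : (\bigcup_(C in \bigcup_n b n) C) x by rewrite bcov.
  have [_ /(_ _ bnC)/enlargeP[_ sub]] := bP n.
  by exists (enlarge (a n) C); [exists n => //; exists C | exact: sub].
split; split.
- exact: (@winning1_simulation Gc Go id (fun _ V => V)).
- exact: (@winning1_simulation Go Gc clopen_refinement _ clopen_refinement_cover
    oc_legal2 oc_wins).
- exact: (@winning2_simulation Go Gc clopen_refinement _ clopen_refinement_cover
    oc_legal2 oc_wins set0).
- exact: (@winning2_simulation Gc Go id (fun _ V => V) _ _ _ set0).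
Qed.

Lemma compact_clopen_open_equivalent :
  equivalent_games (compact_clopen_game X) (compact_open_game X).
Proof.
set Gc := compact_clopen_game X; set Go := compact_open_game X.
have oc_legal2 (K : move1 Go) (U : move2 Gc) :
    legal1 K -> @legal2 Gc K U -> @legal2 Go K U.
  by move=> _ [[Uo _] KU].
have co_legal2 (K : move1 Gc) (U : move2 Go) :
    legal1 K -> @legal2 Go K U -> @legal2 Gc K (clopen_core K U).
  by move=> cK [Uo KU]; have [] := clopen_coreP cK Uo KU.
have co_wins (a : nat -> move1 Gc) (b : nat -> move2 Go) :
    (forall n, legal1 (a n)) -> (forall n, @legal2 Go (a n) (b n)) ->
    @one_wins Gc a (fun n => clopen_core (a n) (b n)) -> @one_wins Go a b.
  (* Each core lies inside the open set it came from, so if the cores cover [X], so do the open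
     sets. *)
  move=> aP bP cov x /cov[n _ xn]; exists n => //.
  by have [bo ab] := bP n; have [_ _] := clopen_coreP (aP n) bo ab; apply.
split; split.
- exact: (@winning1_simulation Gc Go id _ _ co_legal2 co_wins).
- exact: (@winning1_simulation Go Gc id (fun _ U => U)).
- exact: (@winning2_simulation Go Gc id (fun _ U => U) _ _ _ set0).
- exact: (@winning2_simulation Gc Go id _ _ co_legal2 co_wins set0).
Qed.

End ZeroDimensional.

Theorem theorem3p2 (X : topologicalType) (hX : zero_dimensional_space X) :
  equivalent_games (Gfin (clopen_covers X) (clopen_covers X))
                   (Gfin (open_covers X) (open_covers X)) /\
  equivalent_games (compact_clopen_game X) (compact_open_game X).
Proof.
split; first exact: Gfin_clopen_open_equivalent.
exact: compact_clopen_open_equivalent.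
Qed.
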